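(* Let $\beta\in\bigl(1,\frac{1+\sqrt5}{2}\bigr)$ and $m=2$, and let $\kappa=\kappa(\beta)>0$ be a constant such that $\liminf_{n\to\infty}\frac1n\log_2\mathcal N_n(x;\beta)\ge\kappa$ for every $x\in\bigl(0,\frac1{\beta-1}\bigr)$. Then, with $\mu=\mu_{\beta,2}$, $$\overline d(\mu,x)\le(1-\kappa)\log_\beta2\qquad\text{for all }x\in\Bigl(0,\frac1{\beta-1}\Bigr).$$
   Context: For $\beta\in(1,2)$ and $x\in[0,\frac1{\beta-1}]$, let $\mathcal E_n(x;\beta)$ be the set of words $(\varepsilon_1,\dots,\varepsilon_n)\in\{0,1\}^n$ for which there exists $(\varepsilon_{n+1},\varepsilon_{n+2},\dots)\in\{0,1\}^{\mathbb N}$ with $x=\sum_{k=1}^\infty\varepsilon_k\beta^{-k}$, and let $\mathcal N_n(x;\beta)=\#\mathcal E_n(x;\beta)$. For every $\beta\in(1,\frac{1+\sqrt5}2)$ a constant $\kappa>0$ as in the claim exists. The measure $\mu=\mu_{\beta,2}$ (the Bernoulli convolution associated with $\beta$) is the Borel probability measure on $\mathbb R$ given by $\mu(E)=\mathbb P\{(\varepsilon_1,\varepsilon_2,\dots)\in\{0,1\}^{\mathbb N}:\sum_{k=1}^\infty\varepsilon_k\beta^{-k}\in E\}$, where $\mathbb P=\prod_1^\infty\{\frac12,\frac12\}$. The upper local dimension is $\overline d(\mu,x)=\limsup_{r\to0}\frac{\log\mu([x-r,x+r])}{\log r}$. *)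

(* Defs.v *)
From HB Require Import structures.
From mathcomp Require Import all_boot all_order all_algebra.
From mathcomp Require Import all_classical all_reals all_analysis.
From mathcomp Require Import measurable_realfun.

Set Implicit Arguments.
Unset Strict Implicit.
Unset Printing Implicit Defensive.
Import Order.TTheory GRing.Theory Num.Theory.
Import numFieldNormedType.Exports.
Local Open Scope classical_set_scope.
Local Open Scope ring_scope.

Definition coordinate_sets : set (set (nat -> bool)) :=
  [set A | exists k b, A = [set e | e k = b]].

(* {0,1}^N with its product sigma-algebra.  The digits, numbered 1, 2, ... in
   the mathematics, are numbered 0, 1, ... here. *)
Definition coin_space := g_sigma_algebraType coordinate_sets.

Definition cylinder n (w : n.-tuple bool) : set coin_space :=
  [set e | forall i : 'I_n, e i = tnth w i].

Lemma measurable_coordinate k b : measurable ([set e | e k = b] : set coin_space).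
Proof. by apply: sub_sigma_algebra; exists k, b. Qed.

Section existence.
Context (R : realType).

Definition bin_digits (x : R) : coin_space :=
  fun k => odd (Num.truncn (x * 2 ^+ k.+1)).

Let bin_value (e : nat -> bool) n := (\sum_(i < n) e i * 2 ^ (n - i.+1))%N.

Let bin_valueS e n : bin_value e n.+1 = (e n + (bin_value e n).*2)%N.
Proof.
rewrite /bin_value big_ord_recr/= subnn muln1 addnC; congr addn.
rewrite -mul2n big_distrr/=; apply: eq_bigr => i _.
by rewrite subSS mulnCA -expnS -subSn.
Qed.

Let bin_value_lt e n : (bin_value e n < 2 ^ n)%N.
Proof.
elim: n => [|n ih]; first by rewrite /bin_value big_ord0.
rewrite bin_valueS expnS mul2n; case: (e n); rewrite ?add0n ?add1n.
  by rewrite ltn_Sdouble.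
by rewrite ltn_double.
Qed.

Let truncnM2 (y : R) : 0 <= y ->
  Num.truncn (y * 2) = (odd (Num.truncn (y * 2)) + (Num.truncn y).*2)%N.
Proof.
move=> y0; have y20 : 0 <= y * 2 by rewrite mulr_ge0.
set m := Num.truncn (y * 2).
have /andP[m1 m2] : m%:R <= y * 2 < m.+1%:R by exact: truncn_itv.
suff -> : Num.truncn y = m./2 by rewrite odd_double_half.
apply: truncn_def; apply/andP; split.
  rewrite -(@ler_pM2r _ 2)// (le_trans _ m1)// -natrM ler_nat muln2.
  by rewrite -[leqRHS]odd_double_half leq_addl.
rewrite -(@ltr_pM2r _ 2)// (lt_le_trans m2)// -natrM ler_nat muln2.
rewrite -[ltnLHS]odd_double_half doubleS.
by case: (odd m).
Qed.

Let bin_digitsP (e : nat -> bool) n (x : R) : 0 <= x < 1 ->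
  (forall i, (i < n)%N -> bin_digits x i = e i) <->
  Num.truncn (x * 2 ^+ n) = bin_value e n.
Proof.
move=> /andP[x0 x1]; elim: n => [|n ih].
  split=> // _; rewrite /bin_value big_ord0 expr0 mulr1.
  by apply: truncn_def; rewrite x0.
have E : Num.truncn (x * 2 ^+ n.+1) =
    (bin_digits x n + (Num.truncn (x * 2 ^+ n)).*2)%N.
  by rewrite /bin_digits exprSr mulrA {1}truncnM2// mulr_ge0// exprn_ge0.
rewrite E bin_valueS; split=> [h|h].
  by rewrite h// (ih.1 _)// => i ni; apply: h; rewrite ltnW.
have hn : bin_digits x n = e n.
  by have /(congr1 odd) := h; rewrite !oddD !odd_double !addbF !oddb.
move: h; rewrite hn => /addnI /double_inj h i.
rewrite ltnS leq_eqVlt => /predU1P[->//|]; exact: ih.2.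
Qed.

Lemma measurable_bin_digits : 
  @measurable_fun _ _ (measurableTypeR R) coin_space setT bin_digits.
Proof.
apply: (@measurability _ _ (measurableTypeR R) coin_space setT bin_digits coordinate_sets) => //.
move=> _ [_ [k [b ->]] <-]; rewrite setTI.
rewrite (_ : _ @^-1` _ = \bigcup_(m in [set m | odd m = b])
   [set x : R | Num.truncn (x * 2 ^+ k.+1) = m]); last first.
  by apply/seteqP; split=> [x /= <-|x [m /= <- <-]//]; exists (Num.truncn (x * 2 ^+ k.+1)).
apply: bigcup_measurable => m _.
have p0 : 0 < 2 ^+ k.+1 :> R by rewrite exprn_gt0.
have tE n : [set x : R | (Num.truncn (x * 2 ^+ k.+1) <= n)%N] =
    `]-oo, n.+1%:R / 2 ^+ k.+1[%classic.
  by apply/seteqP; split=> x /=; rewrite in_itv/= truncn_le_nat ltr_pdivlMr.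
case: m => [|m].
  rewrite (_ : mkset _ = [set x : R | (Num.truncn (x * 2 ^+ k.+1) <= 0)%N]); last first.
    by apply/seteqP; split=> x /=; [move=> ->|rewrite leqn0 => /eqP].
  by rewrite tE.
rewrite (_ : mkset _ = [set x : R | (Num.truncn (x * 2 ^+ k.+1) <= m.+1)%N] `\`
   [set x : R | (Num.truncn (x * 2 ^+ k.+1) <= m)%N]); last first.
  apply/seteqP; split=> x /=; first by move=> ->; split=> //; rewrite ltnn.
  by move=> [h1 /negP h2]; apply/eqP; rewrite eqn_leq h1 ltnNge.
by rewrite !tE; exact: measurableD.
Qed.

Let mI : measurable (`[0, 1[ : set (measurableTypeR R)). Proof. exact: measurable_itv. Qed.

Definition lebesgue01 := mrestr (@lebesgue_measure R) mI.

HB.instance Definition _ := Measure.on lebesgue01.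

Let lebesgue01_setT : lebesgue01 setT = 1%E.
Proof.
rewrite /lebesgue01 /mrestr setTI lebesgue_measure_itv/= lte_fin ltr01.
by rewrite oppr0 adde0.
Qed.

HB.instance Definition _ :=
  Measure_isProbability.Build _ _ _ lebesgue01 lebesgue01_setT.

Lemma ex_fair_coin : exists P : probability coin_space R,
  forall n (w : n.-tuple bool), P (cylinder w) = (2^-1 ^+ n)%:E.
Proof.
exists (distribution lebesgue01
  (@mfun_Sub _ _ (measurableTypeR R) coin_space bin_digits
    (mem_set measurable_bin_digits))) => n w.
pose e k := nth false w k; pose N := bin_value e n.
have p0 : 0 < 2 ^+ n :> R by rewrite exprn_gt0.
change (lebesgue_measure (bin_digits @^-1` cylinder w `&` `[0, 1[%classic) =
  (2^-1 ^+ n)%:E).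
rewrite (_ : _ `&` _ = `[N%:R / 2 ^+ n, N.+1%:R / 2 ^+ n[%classic).
  rewrite lebesgue_measure_itv/= lte_fin ltr_pM2r ?invr_gt0// ltr_nat ltnSn.
  by rewrite -EFinD -mulrBl -natrB// subSnn mul1r exprVn.
have cP x : cylinder w (bin_digits x) <->
    (forall i, (i < n)%N -> bin_digits x i = e i).
  split=> [h i ni|h i]; last by rewrite h// (tnth_nth false).
  by rewrite (h (Ordinal ni)) (tnth_nth false).
apply/seteqP; split=> x /=; rewrite !in_itv/=.
  move=> [/cP h x01]; have x0 : 0 <= x by case/andP: x01.
  move/bin_digitsP : h => /(_ x01) /eqP.
  by rewrite truncn_eq ?mulr_ge0 ?exprn_ge0// ler_pdivrMr// ltr_pdivlMr.
rewrite ler_pdivrMr// ltr_pdivlMr// => xN.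
have x01 : 0 <= x < 1.
  have /andP[h1 h2] := xN; apply/andP; split.
    by rewrite -(@pmulr_lge0 _ (2 ^+ n)) // (le_trans _ h1).
  rewrite -(@ltr_pM2r _ (2 ^+ n))// mul1r (lt_le_trans h2)// -natrX ler_nat.
  exact: bin_value_lt.
split=> //; apply/cP; apply/bin_digitsP => //; exact: truncn_def.
Qed.

End existence.

(* The product of the fair measures on {0,1}: by fair_coinE its values on
   cylinders are those of the product measure, and cylinders form a pi-system
   generating the sigma-algebra.  The binary digits of a Lebesgue-random point
   of [0, 1[ only serve to show that it exists. *)
Definition fair_coin (R : realType) : probability coin_space R :=
  projT1 (cid (ex_fair_coin R)).

Lemma fair_coinE (R : realType) n (w : n.-tuple bool) :
  fair_coin R (cylinder w) = (2^-1 ^+ n)%:E.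
Proof. exact: (projT2 (cid (ex_fair_coin R))). Qed.

Section expansions.
Context (R : realType).
Implicit Types beta x : R.

Definition expansion beta (e : coin_space) : R :=
  limn (series (fun k => (e k)%:R / beta ^+ k.+1)).

Lemma cvg_expansion beta (e : coin_space) : 1 < beta ->
  series (fun k => (e k)%:R / beta ^+ k.+1) @ \oo --> expansion beta e.
Proof.
move=> b1; have b0 : 0 < beta by rewrite (lt_trans _ b1).
suff : cvgn (series (fun k => (e k)%:R / beta ^+ k.+1)) by [].
have Vb : `|beta^-1| < 1 by rewrite ger0_norm ?invr_ge0 ?ltW// invf_lt1.
apply: (series_le_cvg _ _ _ (is_cvg_geometric_series (a := beta^-1) Vb)) => k.
- by rewrite divr_ge0// exprn_ge0// ltW.
- by rewrite /geometric/= mulr_ge0// ?exprn_ge0// invr_ge0 ltW.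
- rewrite /geometric/= -exprS exprVn ler_piMl ?invr_ge0 ?exprn_ge0 ?(ltW b0)//.
  by case: (e k).
Qed.

Lemma measurable_expansion beta : 1 < beta ->
  measurable_fun [set: coin_space] (expansion beta).
Proof.
move=> b1.
apply: (@measurable_fun_cvg _ coin_space R setT
  (fun n (e : coin_space) => series (fun k => (e k)%:R / beta ^+ k.+1) n)
  (expansion beta)); last first.
  by move=> e _; exact: cvg_expansion.
move=> n; rewrite /series/=; apply: measurable_sum => k.
apply: measurable_funM => //.
apply: (@measurableT_comp _ _ _ _ _ _ (fun b : bool => b%:R : R)) => //.
apply: (measurable_fun_bool true); rewrite setTI.
exact: measurable_coordinate.
Qed.

Definition expansion_prefixes beta x n : {set n.-tuple bool} :=
  [set w : n.-tuple bool |
    `[< exists2 e : coin_space, cylinder w e & x = expansion beta e >]]%SET.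

Definition num_prefixes beta x n : nat := #|expansion_prefixes beta x n|.

(* By measurable_expansion this is a Borel probability measure if 1 < beta. *)
Definition bernoulli_convolution beta : set R -> \bar R :=
  pushforward (fair_coin R) (expansion beta).

Definition logb (b y : R) : R := ln y / ln b.

(* The extended logarithm makes the dimension +oo when some ball around x is
   null; with ln, for which ln 0 = 0, it would be 0. *)
Definition upper_local_dim (mu : set R -> \bar R) x : \bar R :=
  limf_esup
    (fun r : R => lne (mu `[(x - r)%R, (x + r)%R]%classic) / (ln r)%:E)%E 0^'+.

End expansions.

(* Main.v *)
Require Import Defs.
From mathcomp Require Import all_boot all_order all_algebra.
From mathcomp Require Import all_classical all_reals all_analysis.
From mathcomp Require Import ring lra.
Import Order.TTheory GRing.Theory Num.Theory.
Import numFieldNormedType.Exports.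
Local Open Scope classical_set_scope.
Local Open Scope ring_scope.

(** Two expansions in base beta that agree on their first n digits differ by at
    most C beta^-n, where C = 1 / (beta - 1) is the sum of the beta^-k, k >= 1.
    Hence every coin sequence that starts with a prefix of some expansion of x
    is sent into the ball of radius C beta^-n around x
    ([expansion_dist_le]).  The cylinders of the N_n different prefixes are
    disjoint and have mass 2^-n each, so this ball has mass at least N_n 2^-n
    ([bernoulli_convolution_ball_ge]).  By the growth hypothesis, for every
    kappa' < kappa this mass is eventually at least 2^(- (1 - kappa') n).

    An upper local dimension can be tested along the radii C beta^-n, because
    consecutive radii have a bounded ratio, which is negligible against log r
    ([upper_local_dim_le_of_geometric_radii]).  Masses 2^(- (1 - kappa') n) at
    radii C beta^-n give the bound (1 - kappa') log_beta 2, and kappa' tends to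
    kappa. *)

Lemma limf_esup_le_near (R : realType) (T : choiceType) (X : filteredType T)
    (f : X -> \bar R) (F : set_system X) (c : \bar R) :
  (\forall x \near F, (f x <= c)%E) -> (limf_esup f F <= c)%E.
Proof.
move=> fc; rewrite limf_esupE.
apply: (@le_trans _ _ (ereal_sup (f @` [set x | (f x <= c)%E]))).
  by apply: ereal_inf_lbound; exists [set x | (f x <= c)%E].
by apply: ge_ereal_sup => _ [y /= fy <-].
Qed.

Lemma limn_einf_gt_near (R : realType) (u : (\bar R)^nat) (c : \bar R) :
  (c < limn_einf u)%E -> \forall n \near \oo, (c < u n)%E.
Proof.
rewrite /limn_einf /limn_esup limf_esupE lteNr => /ereal_inf_lt.
move=> [_ [A Aoo <-] supA].
near=> n; rewrite -lteN2; apply: le_lt_trans supA.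
by apply: ereal_sup_ubound; exists n => //; near: n.
Unshelve. all: by end_near. Qed.

(** Past the common prefix, the difference of the two series is dominated by the
    geometric series of the beta^-(k+1) for k >= n, whose sum is the bound. *)
Lemma expansion_dist_le (R : realType) (beta : R) n (e e' : coin_space) :
    1 < beta -> (forall i, (i < n)%N -> e i = e' i) ->
  `|expansion beta e - expansion beta e'| <= beta ^- n / (beta - 1).
Proof.
move=> b1 ee'; have b0 : 0 < beta by rewrite (lt_trans _ b1).
have bB0 : 0 < beta - 1 by rewrite subr_gt0.
pose s (d : coin_space) := series (fun k => (d k)%:R / beta ^+ k.+1 : R).
have sn : s e n = s e' n.
  by apply: eq_big_nat => i /andP[_ ni]; rewrite ee'.
(* The exact partial sums of the geometric tail make the induction close. *)
have dist_le m : `|s e (n + m)%N - s e' (n + m)%N| <=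
    (beta ^- n - beta ^- (n + m)) / (beta - 1).
  elim: m => [|m ih]; first by rewrite addn0 sn !subrr normr0 mul0r.
  rewrite addnS /s !seriesSr opprD addrACA.
  apply: (le_trans (ler_normD _ _)).
  have -> : (beta ^- n - beta ^- (n + m).+1) / (beta - 1) =
      (beta ^- n - beta ^- (n + m)) / (beta - 1) + beta ^- (n + m).+1.
    rewrite exprS; field.
    by rewrite ?expf_neq0 ?gt_eqF.
  apply: lerD => //.
  have v0 : 0 <= beta ^- (n + m).+1 by rewrite invr_ge0 exprn_ge0// ltW.
  rewrite -mulrBl normrM [X in _ * X]ger0_norm//; apply: ler_piMl => //.
  case: (e _) (e' _) => [] [];
    by rewrite ?subrr ?subr0 ?sub0r ?normrN ?normr0 ?normr1.
have cv : `|s e N - s e' N| @[N --> \oo] -->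
    `|expansion beta e - expansion beta e'|.
  by apply: cvg_norm; apply: cvgB; exact: cvg_expansion.
have vN N : 0 <= beta ^- N / (beta - 1).
  by rewrite divr_ge0 ?invr_ge0 ?exprn_ge0// ltW.
rewrite -(cvg_lim _ cv)//; apply: limr_le.
  by apply/cvg_ex; eexists; exact: cv.
near=> N; have nN : (n <= N)%N by near: N; exact: nbhs_infty_ge.
have := dist_le (N - n)%N; rewrite subnKC// => /le_trans; apply.
by rewrite mulrBl gerBl.
Unshelve. all: by end_near. Qed.

Lemma measurable_cylinder n (w : n.-tuple bool) : measurable (cylinder w).
Proof.
rewrite (_ : cylinder w =
  \bigcap_(i in [set: 'I_n]) [set e | e (i : nat) = tnth w i]).
  by apply: fin_bigcap_measurable => // i _; exact: measurable_coordinate.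
by apply/seteqP; split=> e /= h i => [_|]; exact: h.
Qed.

Lemma trivIset_cylinder n (D : set (n.-tuple bool)) :
  trivIset D (@cylinder n).
Proof.
move=> w w' _ _ [e [ew ew']].
by apply: eq_from_tnth => i; rewrite -ew ew'.
Qed.

Lemma fair_coin_bigcup_cylinder (R : realType) n (A : {set n.-tuple bool}) :
  fair_coin R (\bigcup_(w in [set` A]) cylinder w) =
    (#|A|%:R * 2^-1 ^+ n)%:E.
Proof.
rewrite measure_fin_bigcup//; last 2 first.
- exact: trivIset_cylinder.
- by move=> w _; exact: measurable_cylinder.
rewrite (eq_fsbigr (fun=> (2^-1 ^+ n)%:E)); last first.
  by move=> w _; exact: fair_coinE.
rewrite -(bigfs _ (index_enum_uniq _))//; last first.
  by move=> w _; rewrite mem_index_enum.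
by rewrite sumEFin sumr_const mulr_natl.
Qed.

(** All the sequences in the cylinders of prefixes of x are sent into the ball,
    because each such cylinder contains an expansion of x itself. *)
Lemma bernoulli_convolution_ball_ge (R : realType) (beta x r : R) n :
    1 < beta -> beta ^- n / (beta - 1) <= r ->
  (((num_prefixes beta x n)%:R * 2^-1 ^+ n)%:E <=
    bernoulli_convolution beta `[(x - r)%R, (x + r)%R]%classic)%E.
Proof.
move=> b1 nr; rewrite -fair_coin_bigcup_cylinder; apply: le_measure.
- rewrite inE; apply: fin_bigcup_measurable => // w _.
  exact: measurable_cylinder.
- rewrite inE -[X in measurable X]setTI.
  by apply: measurable_expansion => //; exact: measurable_itv.
- move=> e [w /=]; rewrite /expansion_prefixes inE => /asboolP[e' e'w ->] ew.
  rewrite /= in_itv/= -ler_distlC distrC; apply: le_trans nr.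
  apply: expansion_dist_le => // i ni.
  by rewrite (ew (Ordinal ni)) (e'w (Ordinal ni)).
Qed.

(** For a small radius r, take the first n with C b^-n below r: up to a bounded
    error, n is - log_b r, so the mass exp(- n q) of the smaller ball gives
    the exponent n q / - ln r, which tends to q / ln b.  Asking for the mass
    bound at all radii r above C b^-n, instead of at C b^-n only, replaces the
    monotonicity of mu. *)
Lemma upper_local_dim_le_of_geometric_radii (R : realType)
    (mu : set R -> \bar R) (x b C q : R) :
    1 < b -> 0 < C ->
    (forall r, (mu `[(x - r)%R, (x + r)%R]%classic <= 1)%E) ->
    (\forall n \near \oo, forall r, C / b ^+ n <= r ->
      ((expR (- (n%:R * q)))%:E <= mu `[(x - r)%R, (x + r)%R]%classic)%E) ->
  (upper_local_dim mu x <= (q / ln b)%:E)%E.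
Proof.
move=> b1 C0 mu1 [n0 _ muge].
have b0 : 0 < b by rewrite (lt_trans _ b1).
have lb0 : 0 < ln b by exact: ln_gt0.
(* Masses are at most 1, which forces q to be nonnegative. *)
have q0 : 0 <= q.
  have := le_trans (muge n0.+1 (leqW (leqnn n0)) _ (lexx _)) (mu1 _).
  by rewrite lee_fin -expR0 ler_expR oppr_le0 pmulr_rge0.
apply/lee_addgt0Pr => eps eps0; rewrite -EFinD.
apply: limf_esup_le_near.
(* It remains to make - ln r large: at least 1 for the sign of ln r, large
   enough for n to exceed n0, and large enough for eps to absorb the bounded
   error. *)
have lnr (M : R) : \forall r \near 0^'+, M <= - ln r.
  by have /cvgrNyPle/(_ (- M)) := @lnNy R; apply: filterS => r; rewrite lerNr.
near=> r.
have r0 : 0 < r by near: r; exact: nbhs_right_gt.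
have t0 : 1 <= - ln r by near: r; exact: lnr.
have tn0 : n0%:R * ln b - ln C <= - ln r by near: r; exact: lnr.
have teps : (ln C + ln b) * (q / ln b) / eps <= - ln r by near: r; exact: lnr.
pose y := (ln C - ln r) / ln b; pose n := (Num.truncn y).+1.
have n0y : n0%:R <= y by rewrite ler_pdivlMr// -lerBlDl.
have /andP[yn1 yn2] : (Num.truncn y)%:R <= y < n%:R.
  by apply: truncn_itv; exact: le_trans n0y.
have n0n : (n0 <= n)%N by rewrite -(@ler_nat R) (le_trans n0y)// ltW.
have rn : C / b ^+ n <= r.
  rewrite -ler_ln ?posrE ?divr_gt0 ?exprn_gt0//.
  rewrite ln_div ?posrE ?exprn_gt0// lnXn// -mulr_natl.
  by move: yn2; rewrite ltr_pdivrMr// lerBlDr -lerBlDl => /ltW.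
have mur := muge n n0n r rn.
have [p mup] : exists p, mu `[(x - r)%R, (x + r)%R]%classic = p%:E.
  move: mur (mu1 r); case: (mu _) => [p _ _|//|//]; by exists p.
move: mur; rewrite mup lee_fin => pge.
have p0 : 0 < p by apply: lt_le_trans pge; exact: expR_gt0.
have lnp : - (n%:R * q) <= ln p by rewrite -ler_expR lnK ?posrE.
have lr0 : ln r < 0 by rewrite -oppr_gt0 (lt_le_trans _ t0).
rewrite lne_EFin// inver lt_eqF// -EFinM lee_fin ler_ndivrMr//.
apply: le_trans lnp; rewrite lerNr.
apply: (@le_trans _ _ ((y + 1) * q)).
  by apply: ler_wpM2r => //; rewrite /n -natr1 lerD2r.
have -> : (y + 1) * q = (ln C + ln b) * (q / ln b) + (q / ln b) * - ln r.
  by rewrite /y; field; rewrite gt_eqF.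
by rewrite -mulrN [leRHS]mulrDl addrC lerD2l [eps * _]mulrC -ler_pdivrMr.
Unshelve. all: by end_near. Qed.

Theorem corollary1p6 (R : realType) (beta kappa : R)
    (beta_gt1 : 1 < beta) (beta_lt_golden : beta < (1 + Num.sqrt 5) / 2)
    (kappa_gt0 : 0 < kappa)
    (num_prefixes_growth : forall x : R, 0 < x -> x < (beta - 1)^-1 ->
      (kappa%:E <=
        limn_einf (fun n => (n%:R^-1 * logb 2 (num_prefixes beta x n)%:R)%:E))%E)
    (x : R) (x_gt0 : 0 < x) (x_lt : x < (beta - 1)^-1) :
  (upper_local_dim (bernoulli_convolution beta) x
    <= ((1 - kappa) * logb beta 2)%:E)%E.
Proof.
have lb0 : 0 < ln beta by exact: ln_gt0.
have l20 : 0 < ln 2 :> R by rewrite ln_gt0// ltr1n.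
have L0 : 0 < logb beta 2 by exact: divr_gt0.
apply/lee_addgt0Pr => eps eps0; rewrite -EFinD.
(* kappa - d plays the role of kappa'; it has to stay nonnegative, so that
   the growth bound excludes a vanishing number of prefixes. *)
pose d := Num.min (kappa / 2) (eps / logb beta 2).
have d0 : 0 < d by rewrite lt_min !divr_gt0.
have dk : d < kappa by rewrite gt_min; apply/orP; left; lra.
have deps : d * logb beta 2 <= eps by rewrite -ler_pdivlMr// ge_min lexx orbT.
apply: (@le_trans _ _ ((1 - (kappa - d)) * ln 2 / ln beta)%:E); last first.
  by rewrite lee_fin -mulrA -/(logb beta 2); lra.
apply: (@upper_local_dim_le_of_geometric_radii _ _ _ _ (beta - 1)^-1) => //.
- by rewrite invr_gt0 subr_gt0.
- move=> r; apply: probability_le1; rewrite -[X in measurable X]setTI.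
  by apply: measurable_expansion => //; exact: measurable_itv.
have /limn_einf_gt_near : ((kappa - d)%:E <
    limn_einf (fun n => (n%:R^-1 * logb 2 (num_prefixes beta x n)%:R)%:E))%E.
  apply: lt_le_trans (num_prefixes_growth x x_gt0 x_lt).
  by rewrite lte_fin ltrBlDr ltrDl.
apply: filterS2 (nbhs_infty_gt 0%N) => n n0; rewrite lte_fin => growth r nr.
have n0R : 0 < n%:R :> R by rewrite ltr0n.
set N := num_prefixes beta x n in growth *.
have lnN : n%:R * (kappa - d) * ln 2 < ln N%:R.
  by move: growth; rewrite mulrC ltr_pdivlMr// ltr_pdivlMr// [_ * n%:R]mulrC.
have N0 : 0 < N%:R :> R.
  rewrite ltNge; apply/negP => N0; move: lnN.
  by rewrite (ln0 N0) ltNge !mulr_ge0 ?subr_ge0 ?ltW.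
rewrite mulrC in nr.
apply: le_trans (bernoulli_convolution_ball_ge _ _ _ _ _ beta_gt1 nr).
rewrite lee_fin -/N -[leRHS]lnK ?posrE ?mulr_gt0 ?exprn_gt0 ?invr_gt0//.
rewrite ler_expR lnM ?posrE ?exprn_gt0 ?invr_gt0// lnXn ?invr_gt0//.
by rewrite lnV ?posrE// -mulr_natl; lra.
Qed.
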